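(* For every typing context $\Delta=x_1:A_1,\dots,x_n:A_n$ of $\mathrm{CP}+\mathrm{Mix}_0+\mathrm{Mix}_2$ and every set $X\subseteq[\![\Delta]\!]$, $[\![\mathcal{T}_\Delta[-]\vdash\Delta\Rightarrow\Delta^{L\bot},z:\mathbf{1}]\!](X)=F_\Delta(X)$.
   Context: CP processes and typing: types $A::=\mathbf{1}\mid\bot\mid A\otimes B\mid A⅋B\mid A\oplus B\mid A\&B\mid !A\mid ?A$ with usual linear duality; typing rules: $x\leftrightarrow y\vdash x:A,y:A^\bot$; $x[]\vdash x:\mathbf{1}$; $x().P$ adds $x:\bot$; $\overline{x}[y].(P\mid Q)\vdash\Gamma,\Delta,x:A\otimes B$ from $P\vdash\Gamma,y:A$, $Q\vdash\Delta,x:B$; $x(y).P\vdash\Gamma,x:A⅋B$ from $P\vdash\Gamma,y:A,x:B$; $x.i;P\vdash\Gamma,x:A_1\oplus A_2$ from $P\vdash\Gamma,x:A_i$; $x.\mathrm{case}(P,Q)\vdash\Gamma,x:A_1\&A_2$; $!x(y).P\vdash ?\Delta,x:!A$ from $P\vdash ?\Delta,y:A$; $?x[y].P\vdash\Delta,x:?A$ from $P\vdash\Delta,y:A$; contraction and weakening on $?$-types; cut $(\nu x)(P\mid Q)\vdash\Gamma,\Delta$ from $P\vdash\Gamma,x:A$, $Q\vdash\Delta,x:A^\bot$; $0\vdash\cdot$; mix $P\mid Q\vdash\Gamma,\Delta$. Denotations: $[\![\mathbf{1}]\!]=[\![\bot]\!]=\{*\}$, $[\![A\otimes B]\!]=[\![A⅋B]\!]=[\![A]\!]\times[\![B]\!]$,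 $[\![A_1\oplus A_2]\!]=[\![A_1\&A_2]\!]=\{(i,a)\mid a\in[\![A_i]\!]\}$, $[\![!A]\!]=[\![?A]\!]$ = finite multisets over $[\![A]\!]$; $[\![x_1:A_1,\dots,x_n:A_n]\!]=\prod_i[\![A_i]\!]$; process denotations $[\![P\vdash\Gamma]\!]\subseteq[\![\Gamma]\!]$: forwarder $\{(a,a)\}$; $x[]$: $\{( * )\}$; $0$: $\{()\}$; $x().P$: $\{(\gamma,* )\}$; cut: $\{(\gamma,\delta)\mid\exists a.(\gamma,a)\in[\![P]\!],(\delta,a)\in[\![Q]\!]\}$; output: $\{(\gamma,\delta,(a,b))\mid(\gamma,a)\in[\![P]\!],(\delta,b)\in[\![Q]\!]\}$; input: $\{(\gamma,(a,b))\mid(\gamma,a,b)\in[\![P]\!]\}$; selection $\{(\gamma,(i,a))\mid(\gamma,a)\in[\![P]\!]\}$; branching $\bigcup_i\{(\gamma,(i,a))\mid(\gamma,a)\in[\![P_i]\!]\}$; server: $\{(\biguplus_{j=1}^k\alpha^1_j,\dots,\biguplus_{j=1}^k\alpha^n_j,\langle a_1,\dots,a_k\rangle)\mid k\ge0,\forall j.(\alpha^1_j,\dots,\alpha^n_j,a_j)\in[\![P]\!]\}$; client $\{(\gamma,\langle a\rangle)\mid(\gamma,a)\in[\![P]\!]\}$; weakening $\{(\gamma,\emptyset)\}$; contraction $\{(\gamma,\alpha_1\uplus\alpha_2)\mid(\gamma,\alpha_1,\alpha_2)\in[\![P]\!]\}$; mix: product. Typed contexts $K\vdash\Sigma\Rightarrow\Gamma$: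 $[-]\vdash\Sigma\Rightarrow\Sigma$; $(\nu x)(K\mid Q)\vdash\Sigma\Rightarrow\Gamma,\Delta$ from $K\vdash\Sigma\Rightarrow\Gamma,x:A$, $Q\vdash\Delta,x:A^\bot$; $K\mid P\vdash\Sigma\Rightarrow\Gamma,\Delta$ from $K\vdash\Sigma\Rightarrow\Gamma$, $P\vdash\Delta$. $[\![K]\!]:\mathcal{P}([\![\Sigma]\!])\to\mathcal{P}([\![\Gamma]\!])$: $[\![[-]]\!](X)=X$; $[\![(\nu x)(K\mid Q)]\!](X)=\{(\sigma,\gamma)\mid\exists a.(\sigma,a)\in[\![K]\!](X),(\gamma,a)\in[\![Q]\!]\}$; $[\![K\mid Q]\!](X)=\{(\sigma,\gamma)\mid\sigma\in[\![K]\!](X),\gamma\in[\![Q]\!]\}$. Translation: $\bot^{L\bot}=\bot$; $\mathbf{1}^{L\bot}=\mathbf{1}\otimes\bot$; $(A\otimes B)^{L\bot}=((A^{L\bot}⅋\mathbf{1})\otimes(B^{L\bot}⅋\mathbf{1}))\otimes\bot$; $(A⅋B)^{L\bot}=A^{L\bot}⅋B^{L\bot}$; $(A\oplus B)^{L\bot}=((A^{L\bot}⅋\mathbf{1})\oplus(B^{L\bot}⅋\mathbf{1}))\otimes\bot$; $(A\&B)^{L\bot}=A^{L\bot}\&B^{L\bot}$; $(!A)^{L\bot}=!(A^{L\bot}⅋\mathbf{1})\otimes\bot$; $(?A)^{L\bot}=?((A^{L\bot}⅋\mathbf{1})\otimes\bot)$; $\Delta^{L\bot}=y_1:A_1^{L\bot},\dots,y_n:A_n^{L\bot}$.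 $F_A$: $F_\bot( * )=*$; $F_{\mathbf{1}}( * )=( *,* )$; $F_{A⅋B}(a,b)=(F_A(a),F_B(b))$; $F_{A\otimes B}(a,b)=(((F_A(a),* ),(F_B(b),* )),* )$; $F_{A_1\&A_2}(i,a)=(i,F_{A_i}(a))$; $F_{A_1\oplus A_2}(i,a)=((i,(F_{A_i}(a),* )),* )$; $F_{!A}(\langle a_1..a_k\rangle)=(\langle(F_A(a_1),* ),\dots,(F_A(a_k),* )\rangle,* )$; $F_{?A}(\langle a_1..a_k\rangle)=\langle((F_A(a_1),* ),* ),\dots\rangle$; $F_\Delta(a_1,\dots,a_n)=(F_{A_1}(a_1),\dots,F_{A_n}(a_n),* )$, extended to sets pointwise. Transformers $T^A_{x,x'}\vdash x:A^\bot,x':A^{L\bot}$: $T^\bot_{x,x'}=x\leftrightarrow x'$; $T^{\mathbf{1}}_{x,x'}=\overline{x'}[y].(y\leftrightarrow x\mid x'().0)$; $T^{A\otimes B}_{x,z}=x(y).\overline{z}[z_2].(\overline{z_2}[z_1].(z_1(y').(T^A_{y,y'}\mid z_1[])\mid z_2(x').(T^B_{x,x'}\mid z_2[]))\mid z().0)$; $T^{A⅋B}_{x,x'}=x'(y').\overline{x}[y].(T^A_{y,y'}\mid T^B_{x,x'})$; $T^{!A}_{x,x'}=\overline{x'}[w'].(!w'(w).?x[y].w(y').(T^A_{y,y'}\mid w[])\mid x'().0)$; $T^{?A}_{x,x'}=!x(y).?x'[m].\overline{m}[z].(z(y').(T^A_{y,y'}\mid z[])\mid m().0)$; $T^{A_1\&A_2}_{x,x'}=x'.\mathrm{case}(x.1;T^{A_1}_{x,x'},x.2;T^{A_2}_{x,x'})$;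 $T^{A_1\oplus A_2}_{x,x'}=x.\mathrm{case}(P_1,P_2)$, $P_i=\overline{x'}[w].(w.i;w(y').(T^{A_i}_{x,y'}\mid w[])\mid x'().0)$. Transformer context with closing name ($z$ fresh): $\mathcal{T}_\Delta[-]=(\nu x_n)(\cdots(\nu x_1)([-]\mid T^{A_1}_{x_1,y_1})\cdots\mid T^{A_n}_{x_n,y_n})\mid z[]$, a typed context $\Delta\Rightarrow\Delta^{L\bot},z:\mathbf{1}$. *)

(* Defs.v *)
From HB Require Import structures.
From mathcomp Require Import all_boot zify.
From mathcomp Require Import finmap multiset.
From mathcomp Require Import classical_sets.

Set Implicit Arguments.
Unset Strict Implicit.
Unset Printing Implicit Defensive.

Local Open Scope mset_scope.
Local Open Scope classical_set_scope.
Local Open Scope nat_scope.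

Inductive ty : Type :=
  | One | Bot
  | Tensor of ty & ty | Par of ty & ty
  | Plus of ty & ty | With of ty & ty
  | OfCourse of ty | WhyNot of ty.

Lemma ty_comparable : comparable ty.
Proof. by move=> A B; rewrite /decidable; decide equality. Qed.

HB.instance Definition _ := hasDecEq.Build ty (compareP ty_comparable).

Fixpoint dual (A : ty) : ty :=
  match A with
  | One => Bot
  | Bot => One
  | Tensor A B => Par (dual A) (dual B)
  | Par A B => Tensor (dual A) (dual B)
  | Plus A B => With (dual A) (dual B)
  | With A B => Plus (dual A) (dual B)
  | OfCourse A => WhyNot (dual A)
  | WhyNot A => OfCourse (dual A)
  end.

Definition name : Type := nat.

Definition fresh (s : seq name) : name := (foldr maxn 0 s).+1.

Inductive proc : Type :=
  | Link of name & name             (* x <-> y *)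
  | Cut of name & proc & proc       (* (nu x)(P | Q) *)
  | Stop                            (* 0 *)
  | Mix of proc & proc              (* P | Q *)
  | Close of name                   (* x[] *)
  | Wait of name & proc             (* x().P *)
  | Out of name & name & proc & proc  (* x[y].(P | Q), y bound in P *)
  | In of name & name & proc        (* x(y).P *)
  | Sel1 of name & proc             (* x.1;P *)
  | Sel2 of name & proc             (* x.2;P *)
  | Case of name & proc & proc      (* x.case(P, Q) *)
  | Server of name & name & proc    (* !x(y).P *)
  | Client of name & name & proc.   (* ?x[y].P *)

Definition remove (y : name) (s : seq name) := [seq w <- s | w != y].

Fixpoint fn (P : proc) : seq name :=
  match P with
  | Link x y => [:: x; y]
  | Cut x P Q => remove x (fn P) ++ remove x (fn Q)
  | Stop => [::]
  | Mix P Q => fn P ++ fn Q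
  | Close x => [:: x]
  | Wait x P => x :: fn P
  | Out x y P Q => x :: remove y (fn P) ++ fn Q
  | In x y P => x :: remove y (fn P)
  | Sel1 x P => x :: fn P
  | Sel2 x P => x :: fn P
  | Case x P Q => x :: fn P ++ fn Q
  | Server x y P => x :: remove y (fn P)
  | Client x y P => x :: remove y (fn P)
  end.

Definition avoid (y : name) (s : seq name) : name :=
  if y \in s then fresh s else y.

(* Simultaneous capture-avoiding renaming of the free names of P along r: a
   binder is kept unless it would capture the image of a free name. *)
Fixpoint rename (r : name -> name) (P : proc) : proc :=
  match P with
  | Link x y => Link (r x) (r y)
  | Cut x P Q =>
      let x' := avoid x (map r (remove x (fn P) ++ remove x (fn Q))) in
      Cut x' (rename [eta r with x |-> x'] P) (rename [eta r with x |-> x'] Q)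
  | Stop => Stop
  | Mix P Q => Mix (rename r P) (rename r Q)
  | Close x => Close (r x)
  | Wait x P => Wait (r x) (rename r P)
  | Out x y P Q =>
      let y' := avoid y (map r (remove y (fn P))) in
      Out (r x) y' (rename [eta r with y |-> y'] P) (rename r Q)
  | In x y P =>
      let y' := avoid y (map r (remove y (fn P))) in
      In (r x) y' (rename [eta r with y |-> y'] P)
  | Sel1 x P => Sel1 (r x) (rename r P)
  | Sel2 x P => Sel2 (r x) (rename r P)
  | Case x P Q => Case (r x) (rename r P) (rename r Q)
  | Server x y P =>
      let y' := avoid y (map r (remove y (fn P))) in
      Server (r x) y' (rename [eta r with y |-> y'] P)
  | Client x y P =>
      let y' := avoid y (map r (remove y (fn P))) in
      Client (r x) y' (rename [eta r with y |-> y'] P)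
  end.

Definition ctx : Type := seq (name * ty).

Definition dom (G : ctx) : seq name := map fst G.

Definition whynots (D : ctx) : ctx := [seq (p.1, WhyNot p.2) | p <- D].

(* Typing derivations. Contexts are lists of typed names, considered up to order
   by an explicit exchange rule; the principal names of a rule come first. The
   freshness premises make the names of every derivable context distinct.
   Weakening leaves no trace in the process and contraction identifies two free
   names, so a process may have several derivations; they live in Type, because
   the denotation of a judgement is defined by recursion on its derivation. *)
Inductive typed : proc -> ctx -> Type :=
  | t_exchange (P : proc) (G G' : ctx) :
      perm_eq G G' -> typed P G -> typed P G'
  | t_link (x y : name) (A : ty) :
      x != y -> typed (Link x y) [:: (x, A); (y, dual A)]
  | t_cut (x : name) (A : ty) (P Q : proc) (G D : ctx) :
      uniq (dom (G ++ D)) ->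
      typed P ((x, A) :: G) -> typed Q ((x, dual A) :: D) ->
      typed (Cut x P Q) (G ++ D)
  | t_stop : typed Stop [::]
  | t_mix (P Q : proc) (G D : ctx) :
      uniq (dom (G ++ D)) ->
      typed P G -> typed Q D -> typed (Mix P Q) (G ++ D)
  | t_close (x : name) : typed (Close x) [:: (x, One)]
  | t_wait (x : name) (P : proc) (G : ctx) :
      x \notin dom G -> typed P G -> typed (Wait x P) ((x, Bot) :: G)
  | t_out (x y : name) (A B : ty) (P Q : proc) (G D : ctx) :
      uniq (x :: dom (G ++ D)) ->
      typed P ((y, A) :: G) -> typed Q ((x, B) :: D) ->
      typed (Out x y P Q) ((x, Tensor A B) :: G ++ D)
  | t_in (x y : name) (A B : ty) (P : proc) (G : ctx) :
      typed P [:: (y, A), (x, B) & G] ->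
      typed (In x y P) ((x, Par A B) :: G)
  | t_sel1 (x : name) (A B : ty) (P : proc) (G : ctx) :
      typed P ((x, A) :: G) -> typed (Sel1 x P) ((x, Plus A B) :: G)
  | t_sel2 (x : name) (A B : ty) (P : proc) (G : ctx) :
      typed P ((x, B) :: G) -> typed (Sel2 x P) ((x, Plus A B) :: G)
  | t_case (x : name) (A B : ty) (P Q : proc) (G : ctx) :
      typed P ((x, A) :: G) -> typed Q ((x, B) :: G) ->
      typed (Case x P Q) ((x, With A B) :: G)
  | t_server (x y : name) (A : ty) (P : proc) (D : ctx) :
      x \notin dom (whynots D) ->
      typed P ((y, A) :: whynots D) ->
      typed (Server x y P) ((x, OfCourse A) :: whynots D)
  | t_client (x y : name) (A : ty) (P : proc) (G : ctx) :
      x \notin dom G ->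
      typed P ((y, A) :: G) -> typed (Client x y P) ((x, WhyNot A) :: G)
  | t_weaken (x : name) (A : ty) (P : proc) (G : ctx) :
      x \notin dom G -> typed P G -> typed P ((x, WhyNot A) :: G)
  | t_contract (x x1 x2 : name) (A : ty) (P : proc) (G : ctx) :
      x \notin dom G ->
      typed P [:: (x1, WhyNot A), (x2, WhyNot A) & G] ->
      typed (rename [eta id with x1 |-> x, x2 |-> x] P) ((x, WhyNot A) :: G).

(* The disjoint sum is the set of pairs (i, a) with i in {1, 2}. *)
Fixpoint den (A : ty) : choiceType :=
  match A with
  | One | Bot => unit
  | Tensor A B | Par A B => (den A * den B)%type
  | Plus A B | With A B => (den A + den B)%type
  | OfCourse A | WhyNot A => {mset den A}
  end.

Lemma den_dual (A : ty) : den (dual A) = den A.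
Proof. by elim: A => //= [A -> B ->|A -> B ->|A -> B ->|A -> B ->|A ->|A ->]. Qed.

(* A type and its dual have equal denotations, but not convertible ones:
   [dualv A] is the identity seen from [den A] to [den (dual A)]. *)
Definition dualv (A : ty) (a : den A) : den (dual A) :=
  ecast T (Choice.sort T) (esym (den_dual A)) a.

Fixpoint den_ctx (G : ctx) : Type :=
  match G with
  | [::] => unit
  | (_, A) :: G => (den A * den_ctx G)%type
  end.

Fixpoint cat_val (G D : ctx) : den_ctx G -> den_ctx D -> den_ctx (G ++ D) :=
  match G return den_ctx G -> den_ctx D -> den_ctx (G ++ D) with
  | [::] => fun _ d => d
  | (_, A) :: G => fun g d => (g.1, cat_val g.2 d)
  end.

Definition entry : Type := {p : name * ty & den p.2}.

Fixpoint entries (G : ctx) : den_ctx G -> seq entry :=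
  match G return den_ctx G -> seq entry with
  | [::] => fun _ => [::]
  | p :: G =>
    match p return den_ctx (p :: G) -> seq entry with
    | (x, A) => fun g =>
        Tagged (fun p : name * ty => den p.2) (i := (x, A)) g.1 :: entries g.2
    end
  end.

(* [g'] is [g] reordered along an exchange; as the names of a context are
   distinct, it is determined by [g]. *)
Definition reordering (G G' : ctx) (g : den_ctx G) (g' : den_ctx G') : Prop :=
  perm_eq (entries g) (entries g').

Fixpoint empty_bags (D : ctx) : den_ctx (whynots D) :=
  match D return den_ctx (whynots D) with
  | [::] => tt
  | (_, A) :: D => (mset0, empty_bags D)
  end.

Fixpoint add_bags (D : ctx) :
    den_ctx (whynots D) -> den_ctx (whynots D) -> den_ctx (whynots D) :=
  match D return den_ctx (whynots D) -> den_ctx (whynots D) ->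
                 den_ctx (whynots D) with
  | [::] => fun _ _ => tt
  | (_, A) :: D => fun g h => ((g.1 `+` h.1)%mset, add_bags g.2 h.2)
  end.

Fixpoint denote (P : proc) (G : ctx) (d : typed P G) : set (den_ctx G) :=
  match d in typed _ G return set (den_ctx G) with
  | t_exchange P G G' _ d =>
      [set g' | exists2 g, denote d g & reordering g g']
  | t_link x y A _ =>
      [set v | exists a : den A, v = (a, (dualv a, tt))]
  | t_cut x A P Q G D _ d e =>
      [set v | exists g h a,
         [/\ denote d (a, g), denote e (dualv a, h) & v = cat_val g h]]
  | t_stop => [set tt]
  | t_mix P Q G D _ d e =>
      [set v | exists g h, [/\ denote d g, denote e h & v = cat_val g h]]
  | t_close x => [set (tt, tt)]
  | t_wait x P G _ d =>
      [set v | exists2 g, denote d g & v = (tt, g)]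
  | t_out x y A B P Q G D _ d e =>
      [set v | exists g h a b,
         [/\ denote d (a, g), denote e (b, h) & v = ((a, b), cat_val g h)]]
  | t_in x y A B P G d =>
      [set v | exists g a b, denote d (a, (b, g)) /\ v = ((a, b), g)]
  | t_sel1 x A B P G d =>
      [set v | exists g a, denote d (a, g) /\ v = (inl a, g)]
  | t_sel2 x A B P G d =>
      [set v | exists g b, denote d (b, g) /\ v = (inr b, g)]
  | t_case x A B P Q G d e =>
      [set v | exists g a, denote d (a, g) /\ v = (inl a, g)] `|`
      [set v | exists g b, denote e (b, g) /\ v = (inr b, g)]
  | t_server x y A P D _ d =>
      [set v | exists k (a : 'I_k -> den A) (g : 'I_k -> den_ctx (whynots D)),
         (forall j, denote d (a j, g j)) /\
         v = (seq_mset [seq a j | j : 'I_k],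
              \big[@add_bags D/empty_bags D]_(j < k) g j)]
  | t_client x y A P G _ d =>
      [set v | exists g a, denote d (a, g) /\ v = ([mset a], g)]
  | t_weaken x A P G _ d =>
      [set v | exists2 g, denote d g & v = (mset0, g)]
  | t_contract x x1 x2 A P G _ d =>
      [set v | exists g m1 m2,
         denote d (m1, (m2, g)) /\ v = ((m1 `+` m2)%mset, g)]
  end.

Inductive pctx : Type :=
  | Hole
  | KCut of name & pctx & proc      (* (nu x)(K | Q) *)
  | KMix of pctx & proc.            (* K | P *)

(* [ktyped K T G] is the type of derivations of K |- T => G. *)
Inductive ktyped : pctx -> ctx -> ctx -> Type :=
  | k_exchange K T G G' :
      perm_eq G G' -> ktyped K T G -> ktyped K T G'
  | k_hole T : uniq (dom T) -> ktyped Hole T T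
  | k_cut x A K Q T G D :
      uniq (dom (G ++ D)) ->
      ktyped K T ((x, A) :: G) -> typed Q ((x, dual A) :: D) ->
      ktyped (KCut x K Q) T (G ++ D)
  | k_mix K P T G D :
      uniq (dom (G ++ D)) ->
      ktyped K T G -> typed P D -> ktyped (KMix K P) T (G ++ D).

Fixpoint kdenote (K : pctx) (T G : ctx) (d : ktyped K T G) :
    set (den_ctx T) -> set (den_ctx G) :=
  match d in ktyped _ T G return set (den_ctx T) -> set (den_ctx G) with
  | k_exchange K T G G' _ d => fun X =>
      [set g' | exists2 g, kdenote d X g & reordering g g']
  | k_hole T _ => fun X => X
  | k_cut x A K Q T G D _ d e => fun X =>
      [set v | exists g h a,
         [/\ kdenote d X (a, g), denote e (dualv a, h) & v = cat_val g h]]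
  | k_mix K P T G D _ d e => fun X =>
      [set v | exists g h, [/\ kdenote d X g, denote e h & v = cat_val g h]]
  end.

Fixpoint lneg (A : ty) : ty :=
  match A with
  | Bot => Bot
  | One => Tensor One Bot
  | Tensor A B => Tensor (Tensor (Par (lneg A) One) (Par (lneg B) One)) Bot
  | Par A B => Par (lneg A) (lneg B)
  | Plus A B => Tensor (Plus (Par (lneg A) One) (Par (lneg B) One)) Bot
  | With A B => With (lneg A) (lneg B)
  | OfCourse A => Tensor (OfCourse (Par (lneg A) One)) Bot
  | WhyNot A => WhyNot (Tensor (Par (lneg A) One) Bot)
  end.

(* [y] names the translated context: the name x_i becomes y_i = y x_i. *)
Definition lneg_ctx (y : name -> name) (D : ctx) : ctx :=
  [seq (y p.1, lneg p.2) | p <- D].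

Fixpoint F (A : ty) : den A -> den (lneg A) :=
  match A return den A -> den (lneg A) with
  | Bot => fun a => a
  | One => fun a => (a, tt)
  | Tensor A B => fun v => (((F v.1, tt), (F v.2, tt)), tt)
  | Par A B => fun v => (F v.1, F v.2)
  | Plus A B => fun v =>
      (match v with inl a => inl (F a, tt) | inr b => inr (F b, tt) end, tt)
  | With A B => fun v =>
      match v with inl a => inl (F a) | inr b => inr (F b) end
  | OfCourse A => fun m => (seq_mset [seq (F a, tt) | a <- enum_mset m], tt)
  | WhyNot A => fun m => seq_mset [seq ((F a, tt), tt) | a <- enum_mset m]
  end.

Fixpoint F_ctx (y : name -> name) (z : name) (D : ctx) :
    den_ctx D -> den_ctx (lneg_ctx y D ++ [:: (z, One)]) :=
  match D return den_ctx D -> den_ctx (lneg_ctx y D ++ [:: (z, One)]) with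
  | [::] => fun _ => (tt, tt)
  | (x, A) :: D => fun v => (F v.1, F_ctx y z v.2)
  end.

(* [transformer A x x'] is T^A_{x,x'}, with fresh bound names. *)
Fixpoint transformer (A : ty) (x x' : name) : proc :=
  let n := fresh [:: x; x'] in
  match A with
  | Bot => Link x x'
  | One => let y := n in Out x' y (Link y x) (Wait x' Stop)
  | Tensor A B =>
      let y := n in let y' := n.+1 in let w' := n.+2 in
      let z1 := n.+3 in let z2 := n.+4 in
      In x y
        (Out x' z2
           (Out z2 z1
              (In z1 y' (Mix (transformer A y y') (Close z1)))
              (In z2 w' (Mix (transformer B x w') (Close z2))))
           (Wait x' Stop))
  | Par A B =>
      let y := n in let y' := n.+1 in
      In x' y' (Out x y (transformer A y y') (transformer B x x'))
  | OfCourse A =>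
      let y := n in let y' := n.+1 in let w := n.+2 in let w' := n.+3 in
      Out x' w'
        (Server w' w (Client x y (In w y' (Mix (transformer A y y') (Close w)))))
        (Wait x' Stop)
  | WhyNot A =>
      let y := n in let y' := n.+1 in let z := n.+2 in let m := n.+3 in
      Server x y
        (Client x' m
           (Out m z (In z y' (Mix (transformer A y y') (Close z)))
              (Wait m Stop)))
  | With A B =>
      Case x' (Sel1 x (transformer A x x')) (Sel2 x (transformer B x x'))
  | Plus A B =>
      let y' := n in let w := n.+1 in
      Case x
        (Out x' w (Sel1 w (In w y' (Mix (transformer A x y') (Close w))))
           (Wait x' Stop))
        (Out x' w (Sel2 w (In w y' (Mix (transformer B x y') (Close w))))
           (Wait x' Stop))
  end.

Lemma fresh_ltl (x x' : name) : x < fresh [:: x; x'].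
Proof. by rewrite /fresh /=; lia. Qed.

Lemma fresh_ltr (x x' : name) : x' < fresh [:: x; x'].
Proof. by rewrite /fresh /=; lia. Qed.

(* The side conditions are closed by [abstract] to keep the derivations below
   small when they are unfolded. *)
Ltac names := abstract (
  rewrite /= ?inE;
  repeat match goal with
  | |- context [fresh [:: ?x; ?x']] =>
      move: (fresh_ltl x x') (fresh_ltr x x'); move: (fresh [:: x; x']) => ?
  end; lia).

Ltac reorder := abstract (
  apply/permP => ?; rewrite /dom /name;
  repeat progress rewrite /= ?map_cat ?count_cat; lia).

(* The recurring fragments of T^A: w(y').(P | w[]) and x'[w].(P | x'().0) *)
Definition t_boxed (P : proc) (w y' x : name) (A B : ty)
    (h : uniq [:: x; y'; w]) (d : typed P [:: (x, A); (y', B)]) :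
  typed (In w y' (Mix P (Close w))) [:: (w, Par B One); (x, A)].
Proof.
apply: t_in; apply: (@t_exchange _ ([:: (x, A); (y', B)] ++ [:: (w, One)])).
  by reorder.
by apply: t_mix d (t_close w); exact: h.
Defined.

Definition t_shift (P : proc) (x' w x : name) (A B : ty) (h : x' != x)
    (d : typed P [:: (w, B); (x, A)]) :
  typed (Out x' w P (Wait x' Stop)) [:: (x', Tensor B Bot); (x, A)].
Proof.
apply: (@t_out x' w B Bot _ _ [:: (x, A)] [::]) d (t_wait _ t_stop) => //.
by names.
Defined.

Definition t_swap (P : proc) (p q : name * ty) (d : typed P [:: p; q]) :
  typed P [:: q; p].
Proof. by apply: t_exchange d; reorder. Defined.

Definition transformer_typed (A : ty) :
  forall x x' : name, x != x' ->
    typed (transformer A x x') [:: (x, dual A); (x', lneg A)].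
Proof.
elim: A => [||A dA B dB|A dA B dB|A dA B dB|A dA B dB|A dA|A dA] x x' xx' /=.
- apply/t_swap/t_shift; first by names.
  by apply: (@t_link _ x One); names.
- exact: (@t_link x x' One).
- apply: t_in.
  apply: (@t_exchange _ [:: (x', lneg (Tensor A B));
            (fresh [:: x; x'], dual A); (x, dual B)]); first by reorder.
  apply: (@t_out _ _ _ _ _ _ [:: (_, dual A); (x, dual B)] [::]).
  + by names.
  + apply: (@t_out _ _ _ _ _ _ [:: (_, dual A)] [:: (x, dual B)]).
    * by names.
    * by apply: t_boxed (dA _ _ _); names.
    * by apply: t_boxed (dB _ _ _); names.
  + by apply: t_wait t_stop.
- apply: t_swap; apply: t_in.
  apply: (@t_exchange _ [:: (x, dual (Par A B));
            ((fresh [:: x; x']).+1, lneg A); (x', lneg B)]); first by reorder.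
  apply: (@t_out _ _ _ _ _ _ [:: (_, lneg A)] [:: (x', lneg B)]).
  + by names.
  + by apply: dA; names.
  + by apply: dB; names.
- apply: t_case; apply/t_swap/t_shift; try by names.
  + by apply: t_sel1; apply: t_boxed (dA _ _ _); names.
  + by apply: t_sel2; apply: t_boxed (dB _ _ _); names.
- apply: t_swap; apply: t_case; apply: t_swap.
  + by apply/t_sel1/dA.
  + by apply/t_sel2/dB.
- apply/t_swap/t_shift; first by names.
  apply: (@t_server _ _ _ _ [:: (x, dual A)]); first by names.
  apply/t_swap/t_client; first by names.
  by apply/t_swap/t_boxed/dA; names.
- apply: (@t_server _ _ _ _ [:: (x', Tensor (Par (lneg A) One) Bot)]).
    by names.
  apply/t_swap/t_client; first by names.
  by apply/t_shift/t_boxed/dA; names.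
Defined.

Definition transformer_cuts (y : name -> name) : pctx -> ctx -> pctx :=
  foldl (fun K p => KCut p.1 K (transformer p.2 p.1 (y p.1))).

(* (nu x_n)(... (nu x_1)([-] | T^{A_1}_{x_1,y_1}) ... | T^{A_n}_{x_n,y_n}) | z[]
   where y_i = y x_i *)
Definition transformer_ctx (y : name -> name) (z : name) (D : ctx) : pctx :=
  KMix (transformer_cuts y Hole D) (Close z).

Lemma transformer_cuts_names (y : name -> name) (x : name) (A : ty) (D G : ctx) :
  uniq (dom ((x, A) :: D ++ lneg_ctx y ((x, A) :: D) ++ G)) ->
  [/\ x != y x, uniq (dom ((D ++ G) ++ [:: (y x, lneg A)]))
    & uniq (dom (D ++ lneg_ctx y D ++ (y x, lneg A) :: G))].
Proof.
move=> /= /andP[xD].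
rewrite (perm_uniq (s2 :=
  dom (((D ++ G) ++ [:: (y x, lneg A)]) ++ lneg_ctx y D))); last by reorder.
move=> h; split.
- by apply: contraNneq xD => <-; rewrite /dom map_cat mem_cat /= inE eqxx orbT.
- by move: h; rewrite /dom map_cat cat_uniq => /and3P[].
- by rewrite -(perm_uniq (s1 :=
    dom (((D ++ G) ++ [:: (y x, lneg A)]) ++ lneg_ctx y D))) //; reorder.
Qed.

Definition transformer_cuts_typed (y : name -> name) (T D : ctx) :
  forall (K : pctx) (G : ctx), uniq (dom (D ++ lneg_ctx y D ++ G)) ->
    ktyped K T (D ++ G) ->
    ktyped (transformer_cuts y K D) T (lneg_ctx y D ++ G).
Proof.
elim: D => [|[x A] D IHD] K G h d /=; first exact: d.
apply: (@k_exchange _ _ (lneg_ctx y D ++ (y x, lneg A) :: G)); first by reorder.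
apply: IHD; first by case: (transformer_cuts_names h).
apply: (@k_exchange _ _ ((D ++ G) ++ [:: (y x, lneg A)])); first by reorder.
apply: (k_cut _ d (transformer_typed A _)); by case: (transformer_cuts_names h).
Defined.

(* The x_i, the y_i and the closing name z are pairwise distinct. *)
Definition fresh_for (y : name -> name) (z : name) (D : ctx) : bool :=
  uniq (dom D ++ map y (dom D) ++ [:: z]).

Lemma fresh_for_names (y : name -> name) (z : name) (D : ctx) :
  fresh_for y z D ->
  [/\ uniq (dom D), uniq (dom (D ++ lneg_ctx y D ++ [::]))
    & uniq (dom ((lneg_ctx y D ++ [::]) ++ [:: (z, One)]))].
Proof.
have e : map y (dom D) = dom (lneg_ctx y D) by rewrite /dom -!map_comp.
rewrite /fresh_for e !cats0 /dom !map_cat => h; split.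
- by move: h; rewrite cat_uniq => /and3P[].
- by move: h; rewrite catA cat_uniq => /and3P[].
- by move: h; rewrite cat_uniq => /and3P[].
Qed.

Definition transformer_ctx_typed (y : name -> name) (z : name) (D : ctx)
    (h : fresh_for y z D) :
  ktyped (transformer_ctx y z D) D (lneg_ctx y D ++ [:: (z, One)]).
Proof.
apply: (@k_exchange _ _ ((lneg_ctx y D ++ [::]) ++ [:: (z, One)])).
  by reorder.
apply: (k_mix _ _ (t_close z)); first by case: (fresh_for_names h).
apply: transformer_cuts_typed; first by case: (fresh_for_names h).
apply: (@k_exchange _ _ D); first by reorder.
by apply: k_hole; case: (fresh_for_names h).
Defined.

(* Main.v *)
(* As the names of a derivable context are distinct, an exchange acts on
   denotations as a bijection. Induction on A then shows that the transformer
   T^A denotes the graph of F_A, that is, {(a, F_A(a)) | a in [[A]]}: both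
   components of each of its subprocesses are given as functions of a common
   index, with sequences of indices for a server, since each index of the
   server's body uses its client exactly once. Cutting a context against such
   a graph applies F_A to the component cut. *)

Require Import Defs.
From mathcomp Require Import all_boot classical_sets.
From mathcomp Require Import finmap multiset boolp.

Local Open Scope classical_set_scope.

Set Implicit Arguments.
Unset Strict Implicit.

(** * Distinctness of names, and exchange as a function on values *)

Lemma typed_uniq (P : proc) (G : ctx) : typed P G -> uniq (dom G).
Proof.
elim=> //= {P G}.
- by move=> P G G' GG' _; rewrite (perm_uniq (perm_map fst GG')).
- by move=> x y A xy; rewrite inE xy.
- by move=> x P G -> _ ->.
- by move=> x y A B P G _ /and3P[_ -> ->].
- by move=> x y A P D -> _ /andP[_ ->].
- by move=> x y A P G -> _ /andP[_ ->].
- by move=> x A P G -> _ ->.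
- by move=> x x1 x2 A P G -> _ /and3P[_ _ ->].
Qed.

Lemma ktyped_uniq (K : pctx) (T G : ctx) : ktyped K T G -> uniq (dom G).
Proof.
elim=> //= K' T' G1 G2 GG' _.
by rewrite (perm_uniq (perm_map fst GG')).
Qed.

Lemma entries_cat (G D : ctx) (g : den_ctx G) (d : den_ctx D) :
  entries (cat_val g d) = entries g ++ entries d.
Proof. by elim: G g => [|[x A] G IHG] //= g; rewrite IHG. Qed.

Lemma dom_entries (G : ctx) (g : den_ctx G) : [seq (tag e).1 | e <- entries g] = dom G.
Proof. by elim: G g => [|[x A] G IHG] //= g; rewrite IHG. Qed.

(** The head name does not recur in the tail, so the two head entries can only be matched with each
    other; they cancel and induction applies. *)
Lemma reordering_inj (G : ctx) (g h : den_ctx G) :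
  uniq (dom G) -> reordering g h -> g = h.
Proof.
rewrite /reordering; elim: G g h => [|[x A] G IHG] /=; first by move=> [] [].
move=> [a g] [b h] /= /andP[xG uG] gh.
have ab : a = b.
  have := mem_head (Tagged (fun p : name * ty => den p.2) (i := (x, A)) a) (entries g).
  rewrite (perm_mem gh) inE => /orP[/eqP ab|]; first exact: eq_from_Tagged ab.
  by move=> /(map_f (fun e : entry => (tag e).1)); rewrite dom_entries (negPf xG).
by move: gh; rewrite ab perm_cons => /(IHG _ _ uG) ->.
Qed.

Lemma reordering_fun (G G' : ctx) (g : den_ctx G) (g1 g2 : den_ctx G') :
  uniq (dom G') -> reordering g g1 -> reordering g g2 -> g1 = g2.
Proof.
move=> uG gg1 gg2; apply: (reordering_inj uG).
by rewrite /reordering -(permPl gg1).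
Qed.

(** Every exchange in the typing derivation of a transformer moves the head entry to the end, so
    this one reordering suffices there. *)
Definition rot_val (x : name) (A : ty) (G : ctx) (g : den_ctx ((x, A) :: G)) :
    den_ctx (G ++ [:: (x, A)]) :=
  cat_val (D := [:: (x, A)]) g.2 (g.1, tt).

Lemma reordering_rot (x : name) (A : ty) (G : ctx) (g : den_ctx ((x, A) :: G)) :
  reordering g (rot_val g).
Proof. by rewrite /reordering entries_cat /= -cat1s perm_catC. Qed.

Lemma denote_rot (P : proc) (x : name) (A : ty) (G : ctx)
    (e : perm_eq ((x, A) :: G) (G ++ [:: (x, A)])) (d : typed P ((x, A) :: G))
    (I : Type) (U : set I) (p : I -> den_ctx ((x, A) :: G)) :
  denote d = p @` U ->
  denote (t_exchange e d) = [set rot_val (p i) | i in U].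
Proof.
move=> dE; apply/seteqP; rewrite /= dE.
split=> [g' [_ [i Ui <-] gg']|_ [i Ui <-]]; last by exists (p i); [exists i|exact: reordering_rot].
exists i => //; apply: reordering_fun (reordering_rot _) gg'.
exact: typed_uniq (t_exchange e d).
Qed.

Lemma kdenote_exchange (K : pctx) (T G G' : ctx) (e : perm_eq G G')
    (d : ktyped K T G) (I : Type) (U : set I) (X : set (den_ctx T))
    (f : I -> den_ctx G) (f' : I -> den_ctx G') :
  kdenote d X = f @` U -> (forall i, reordering (f i) (f' i)) ->
  kdenote (k_exchange e d) X = f' @` U.
Proof.
move=> dE ff'; apply/seteqP; rewrite /= dE; split=> [g' [_ [i Ui <-] gg']|_ [i Ui <-]].
  exists i => //.
  by apply: reordering_fun gg'; first exact: ktyped_uniq (k_exchange e d).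
by exists (f i); [exists i|].
Qed.

(** * Transport between the denotations of a type and its dual *)

(** The proof [den_dual] is opaque, so the cast in [dualv] does not compute; proof irrelevance
    replaces it by [erefl]. *)
Lemma ecast_id (T : choiceType) (e : T = T) (a : T) : ecast U (Choice.sort U) e a = a.
Proof. by rewrite (Prop_irrelevance e erefl). Qed.

(** The equality [e] is unrelated to [eT] and [eU], but once these are substituted it becomes a loop
    and its cast is the identity. *)
Lemma ecast_pair (T T' U U' : choiceType) (eT : T' = T) (eU : U' = U)
    (e : (T' * U')%type = (T * U)%type :> choiceType) (v : T * U) :
  ecast V (Choice.sort V) (esym e) v =
  (ecast V (Choice.sort V) (esym eT) v.1, ecast V (Choice.sort V) (esym eU) v.2).
Proof. by subst T U; rewrite ecast_id; case: v. Qed.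

Lemma ecast_sum (T T' U U' : choiceType) (eT : T' = T) (eU : U' = U)
    (e : (T' + U')%type = (T + U)%type :> choiceType) (v : T + U) :
  ecast V (Choice.sort V) (esym e) v =
  match v with
  | inl a => inl (ecast V (Choice.sort V) (esym eT) a)
  | inr b => inr (ecast V (Choice.sort V) (esym eU) b)
  end.
Proof. by subst T U; rewrite ecast_id; case: v. Qed.

Lemma ecast_mset (T T' : choiceType) (eT : T' = T)
    (e : {mset T'}%mset = {mset T}%mset :> choiceType) (m : {mset T}%mset) :
  ecast V (Choice.sort V) (esym e) m =
  seq_mset [seq ecast V (Choice.sort V) (esym eT) a | a <- enum_mset m].
Proof. by subst T; rewrite ecast_id map_id seq_mset_id. Qed.

Lemma dualv_tensor (A B : ty) (v : den (Tensor A B)) :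
  dualv v = (dualv v.1, dualv v.2).
Proof. exact: ecast_pair. Qed.

Lemma dualv_par (A B : ty) (v : den (Par A B)) : dualv v = (dualv v.1, dualv v.2).
Proof. exact: ecast_pair. Qed.

Lemma dualv_plus (A B : ty) (v : den (Plus A B)) :
  dualv v = match v with inl a => inl (dualv a) | inr b => inr (dualv b) end.
Proof. exact: ecast_sum. Qed.

Lemma dualv_with (A B : ty) (v : den (With A B)) :
  dualv v = match v with inl a => inl (dualv a) | inr b => inr (dualv b) end.
Proof. exact: ecast_sum. Qed.

Lemma dualv_ofcourse (A : ty) (m : den (OfCourse A)) :
  dualv m = seq_mset [seq dualv a | a <- enum_mset m].
Proof. exact: ecast_mset. Qed.

Lemma dualv_whynot (A : ty) (m : den (WhyNot A)) :
  dualv m = seq_mset [seq dualv a | a <- enum_mset m].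
Proof. exact: ecast_mset. Qed.

(** * Denotations of the typing rules as parametrized sets *)

(** Neither component has to determine the other, so exchanging the two names merely exchanges [f]
    and [g]. The final [unit] is the value of the empty rest of the context. *)
Definition graph (I A B : Type) (f : I -> A) (g : I -> B) : set (A * (B * unit)) :=
  [set (f i, (g i, tt)) | i in [set: I]].

Lemma denote_swap (P : proc) (x y : name) (A B : ty)
    (d : typed P [:: (x, A); (y, B)]) (I : Type) (f : I -> den A) (g : I -> den B) :
  denote d = graph f g -> denote (t_swap d) = graph g f.
Proof.
move=> dE; rewrite /t_swap; exact: (denote_rot (G := [:: (y, B)]) _ dE).
Qed.

Lemma denote_in (P : proc) (x y : name) (A B : ty) (G : ctx)
    (d : typed P [:: (y, A), (x, B) & G]) (I : Type) (U : set I)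
    (p : I -> den_ctx [:: (y, A), (x, B) & G]) :
  denote d = p @` U ->
  denote (t_in d) = [set (((p i).1, (p i).2.1), (p i).2.2) | i in U].
Proof.
move=> dE; rewrite /= dE; apply/seteqP.
split=> [_ [g [a [b [[i Ui pi] ->]]]]|_ [i Ui <-]]; first by exists i; rewrite ?pi.
by exists (p i).2.2, (p i).1, (p i).2.1; split=> //; exists i; case: (p i) => a [].
Qed.

(** The premises share no channel, so their indices vary independently. *)
Lemma denote_out (P Q : proc) (x y : name) (A B : ty) (G D : ctx)
    (h : uniq (x :: dom (G ++ D)))
    (d : typed P ((y, A) :: G)) (e : typed Q ((x, B) :: D))
    (I J : Type) (U : set I) (V : set J)
    (p : I -> den_ctx ((y, A) :: G)) (q : J -> den_ctx ((x, B) :: D)) :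
  denote d = p @` U -> denote e = q @` V ->
  denote (t_out h d e) =
  [set (((p ij.1).1, (q ij.2).1), cat_val (p ij.1).2 (q ij.2).2) | ij in U `*` V].
Proof.
move=> dE eE; rewrite /= dE eE; apply/seteqP.
split=> [_ [g [k [a [b [[i Ui pi] [j Vj qj] ->]]]]]|_ [[i j] [/= Ui Vj] <-]].
  by exists (i, j) => //=; rewrite pi qj.
exists (p i).2, (q j).2, (p i).1, (q j).1; split=> //.
  by exists i => //; case: (p i).
by exists j => //; case: (q j).
Qed.

Lemma denote_wait_stop (x : name) (h : x \notin dom [::]) :
  denote (t_wait h t_stop) = [set (u, tt) | u in [set: unit]].
Proof. by apply/seteqP; split=> [_ [_ -> ->]|_ [[] _ <-]]; exists tt. Qed.

(** The process [w[]] contributes only [tt], so mixing it in leaves the index type unchanged. *)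
Lemma denote_boxed (P : proc) (w y x : name) (A B : ty) (h : uniq [:: x; y; w])
    (d : typed P [:: (x, A); (y, B)]) (I : Type) (f : I -> den A) (g : I -> den B) :
  denote d = graph f g ->
  denote (t_boxed h d) = graph (fun i => (g i, tt)) f.
Proof.
move=> dE; rewrite /t_boxed.
set e := t_mix _ _ _.
have eE : denote e = [set (f i, (g i, (tt, tt))) | i in [set: I]].
  rewrite /= dE; apply/seteqP; split=> [_ [_ [_ [[i _ <-] -> ->]]]|_ [i _ <-]].
    by exists i.
  by exists (f i, (g i, tt)), (tt, tt); split=> //; exists i.
exact: (denote_in (denote_rot _ eE)).
Qed.

Lemma denote_shift (P : proc) (x' w x : name) (A B : ty) (h : x' != x)
    (d : typed P [:: (w, B); (x, A)]) (I : Type) (f : I -> den A) (g : I -> den B) :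
  denote d = graph g f ->
  denote (t_shift h d) = graph (fun i => (g i, tt)) f.
Proof.
move=> dE; rewrite /t_shift /= dE; apply/seteqP.
split=> [_ [_ [_ [_ [_ [[i _ [<- <-]] [_ -> [-> ->]] ->]]]]]|_ [i _ <-]].
  by exists i.
exists (f i, tt), tt, (g i), tt; split=> //; first by exists i.
by exists tt.
Qed.

Lemma denote_sel1 (P : proc) (x x' : name) (A B C : ty)
    (d : typed P [:: (x, A); (x', C)]) (I : Type) (f : I -> den A) (g : I -> den C) :
  denote d = graph f g ->
  denote (t_sel1 B d) = graph (fun i => inl (f i)) g.
Proof.
move=> dE; rewrite /= dE; apply/seteqP; split=> [_ [_ [_ [[i _ [<- <-]] ->]]]|_ [i _ <-]].
  by exists i.
by exists (g i, tt), (f i); split=> //; exists i.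
Qed.

Lemma denote_sel2 (P : proc) (x x' : name) (A B C : ty)
    (d : typed P [:: (x, B); (x', C)]) (I : Type) (f : I -> den B) (g : I -> den C) :
  denote d = graph f g ->
  denote (t_sel2 A d) = graph (fun i => inr (f i)) g.
Proof.
move=> dE; rewrite /= dE; apply/seteqP; split=> [_ [_ [_ [[i _ [<- <-]] ->]]]|_ [i _ <-]].
  by exists i.
by exists (g i, tt), (f i); split=> //; exists i.
Qed.

(** A sum of index types records which branch is taken. *)
Lemma denote_case (P Q : proc) (x x' : name) (A B C : ty)
    (d : typed P [:: (x, A); (x', C)]) (e : typed Q [:: (x, B); (x', C)])
    (I J : Type) (f1 : I -> den A) (g1 : I -> den C)
    (f2 : J -> den B) (g2 : J -> den C) :
  denote d = graph f1 g1 -> denote e = graph f2 g2 ->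
  denote (t_case d e) =
  graph (fun v => match v with inl i => inl (f1 i) | inr j => inr (f2 j) end)
        (fun v => match v with inl i => g1 i | inr j => g2 j end).
Proof.
move=> dE eE; rewrite /= dE eE; apply/seteqP; split.
  move=> _ [[_ [_ [[i _ [<- <-]] ->]]]|[_ [_ [[j _ [<- <-]] ->]]]].
    by exists (inl i).
  by exists (inr j).
move=> _ [[i|j] _ <-]; [left|right].
  by exists (g1 i, tt), (f1 i); split=> //; exists i.
by exists (g2 j, tt), (f2 j); split=> //; exists j.
Qed.

Lemma denote_client (x y : name) (A B : ty) (P : proc) (x' : name)
    (h : x \notin dom [:: (x', B)]) (d : typed P [:: (y, A); (x', B)])
    (I : Type) (f : I -> den A) (g : I -> den B) :
  denote d = graph f g ->
  denote (t_client h d) = graph (fun i => [mset f i]%mset) g.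
Proof.
move=> dE; rewrite /= dE; apply/seteqP; split=> [_ [_ [_ [[i _ [<- <-]] ->]]]|_ [i _ <-]].
  by exists i.
by exists (g i, tt), (f i); split=> //; exists i.
Qed.

Lemma add_bags_sum (x : name) (A : ty) (k : nat) (a : 'I_k -> den A) :
  \big[@add_bags [:: (x, A)]/empty_bags [:: (x, A)]]_(j < k) ([mset a j]%mset, tt)
  = (seq_mset [seq a j | j : 'I_k], tt).
Proof.
rewrite /index_enum -enumT /image_mem.
(* Both sides run over the same enumeration of ['I_k], generalized here to any sequence. *)
elim: (enum 'I_k) => [|j s IHs]; first by rewrite big_nil; congr pair; apply/esym/msetP => b; rewrite mset_seqE mset0E.
rewrite big_cons IHs /=; congr pair; apply/esym/msetP => b.
by rewrite mset1DE !mset_seqE /= eq_sym.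
Qed.

(** Each copy of the body adds one element to either multiset, both given by the same index, so a
    run of the server amounts to a sequence of indices. *)
Lemma denote_server (x y : name) (A B : ty) (P : proc) (x' : name)
    (h : x \notin dom (whynots [:: (x', B)]))
    (d : typed P ((y, A) :: whynots [:: (x', B)]))
    (I : Type) (f : I -> den A) (g : I -> den B) :
  denote d = graph f (fun i => [mset g i]%mset) ->
  denote (t_server h d) =
  graph (fun s : seq I => seq_mset [seq f i | i <- s])
        (fun s => seq_mset [seq g i | i <- s]).
Proof.
move=> dE; apply/seteqP; split=> [_ [k [a [v [dav ->]]]]|_ [s _ <-]].
  have iP j : exists i, f i = a j /\ v j = ([mset g i]%mset, tt).
    have: graph f (fun i => [mset g i]%mset) (a j, v j) by rewrite -dE; exact: dav.
    by case=> i _ [<- <-]; exists i.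
  (* One index is chosen for each copy of the body. *)
  have [i /all_and2[fi vi]] := choice iP.
  exists [seq i j | j : 'I_k] => //; rewrite (eq_bigr _ (fun j _ => vi j)) add_bags_sum.
  by rewrite /image_mem -!map_comp; congr (seq_mset _, _); apply: eq_map => j /=.
(* Conversely, the copy number [j] is run at the [j]-th index in [s]. *)
pose n := tnth (in_tuple s); have sE : map n (enum 'I_(size s)) = s.
  exact: map_tnth_enum.
exists (size s), (f \o n), (fun j => ([mset g (n j)]%mset, tt)); split=> [j|].
  by rewrite dE; exists (n j).
by rewrite add_bags_sum /image_mem -[in LHS]sE -!map_comp.
Qed.

(** The order of the indices is invisible in both multisets, so sequences may be replaced by
    multisets; this is the form that [F] and [dualv] take at exponentials. *)
Lemma graph_enum_mset (K L M : choiceType) (f : K -> L) (g : K -> M) :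
  graph (fun s => seq_mset [seq f i | i <- s]) (fun s => seq_mset [seq g i | i <- s]) =
  graph (fun m => seq_mset [seq f i | i <- enum_mset m])
        (fun m => seq_mset [seq g i | i <- enum_mset m]).
Proof.
have E (N : choiceType) (k : K -> N) s :
    seq_mset [seq k i | i <- enum_mset (seq_mset s)] = seq_mset [seq k i | i <- s].
  by apply/eq_seq_msetP/perm_map/perm_eq_seq_mset.
apply/seteqP; split=> _ [s _ <-]; last by exists (enum_mset s).
by exists (seq_mset s); rewrite ?E.
Qed.

Lemma eq_graph (I A B : Type) (f f' : I -> A) (g g' : I -> B) :
  f =1 f' -> g =1 g' -> graph f g = graph f' g'.
Proof. by move=> /funext -> /funext ->. Qed.

(** * The denotation of a transformer *)

Lemma denote_transformer (A : ty) (x x' : name) (h : x != x') :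
  denote (transformer_typed A h) = graph (@dualv A) (@F A).
Proof.
elim: A x x' h => [||A IHA B IHB|A IHA B IHB|A IHA B IHB|A IHA B IHB|A IHA|A IHA] x x' h;
  (* Restricted unfolding keeps fragments such as [t_boxed] folded, so that the lemmas about them
     apply. *)
  lazy beta delta [transformer_typed] iota.
- apply/denote_swap/denote_shift.
  by apply/seteqP; split=> [_ [a ->]|_ [a _ <-]]; exists a.
(* All components lie in [unit], so the casts are settled by case analysis on their values. *)
- apply/seteqP; split=> -[[] [[] []]] _; exists tt => //.
    by case: (dualv (A := Bot) tt).
  by case: (dualv (A := One) tt).
- rewrite (eq_graph (@dualv_tensor A B) (frefl _)).
  rewrite (denote_in (denote_rot _ (denote_out _ (denote_out _
    (denote_boxed _ (IHA _ _ _)) (denote_boxed _ (IHB _ _ _))) (denote_wait_stop _)))).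
  (* The extra index in [unit] comes from [x'().0]. *)
  apply/seteqP; split=> [_ [[[a b] []] _ <-]|_ [[a b] _ <-]].
    by exists (a, b).
  by exists ((a, b), tt).
- apply/denote_swap.
  rewrite (eq_graph (frefl _) (@dualv_par A B)).
  rewrite (denote_in (denote_rot _ (denote_out _ (IHA _ _ _) (IHB _ _ _)))).
  by apply/seteqP; split=> _ [[a b] _ <-]; exists (a, b).
- rewrite (eq_graph (@dualv_plus A B) (frefl _)).
  (* [F] has its closing [tt] outside the case analysis, whereas [denote_case] yields one function
     per branch; these are the two restrictions of [F]. *)
  pose F1 a : den (lneg (Plus A B)) := (inl (F a, tt), tt).
  pose F2 b : den (lneg (Plus A B)) := (inr (F b, tt), tt).
  rewrite (denote_case _ _ (f1 := @dualv A) (g1 := F1) (f2 := @dualv B) (g2 := F2)).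
  + by apply: eq_graph => -[].
  + apply/denote_swap/denote_shift; exact: denote_sel1 _ (denote_boxed _ (IHA _ _ _)).
  + apply/denote_swap/denote_shift; exact: denote_sel2 _ (denote_boxed _ (IHB _ _ _)).
- apply/denote_swap; rewrite (eq_graph (frefl _) (@dualv_with A B)).
  rewrite (denote_case (denote_swap (denote_sel1 _ (IHA _ _ _)))
    (denote_swap (denote_sel2 _ (IHB _ _ _)))).
  by apply: eq_graph => -[].
- apply/denote_swap/denote_shift; rewrite (eq_graph (frefl _) (@dualv_ofcourse A)).
  rewrite (denote_server _ (denote_swap (denote_client _ (denote_swap (denote_boxed _ (IHA _ _ _)))))).
  exact: graph_enum_mset.
- rewrite (eq_graph (@dualv_whynot A) (frefl _)).
  rewrite (denote_server _ (denote_swap (denote_client _ (denote_shift _ (denote_boxed _ (IHA _ _ _)))))).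
  exact: graph_enum_mset.
Qed.

(** * Cutting a context against the transformers *)

Lemma dualv_inj (A : ty) : injective (@dualv A).
Proof. by rewrite /dualv; case: _ / (esym (den_dual A)). Qed.

Lemma kdenote_cut_transformer (x x' : name) (A : ty) (K : pctx) (T G : ctx)
    (u : uniq (dom (G ++ [:: (x', lneg A)]))) (d : ktyped K T ((x, A) :: G))
    (h : x != x') (X : set (den_ctx T)) (I : Type) (U : set I)
    (p : I -> den_ctx ((x, A) :: G)) :
  kdenote d X = p @` U ->
  kdenote (k_cut u d (transformer_typed A h)) X =
  [set cat_val (D := [:: (x', lneg A)]) (p i).2 (F (p i).1, tt) | i in U].
Proof.
(* Only the denotation of the transformer matters; abstracting its derivation keeps simplification
   from unfolding it. *)
move=> dE; have := denote_transformer A h; move: (transformer_typed A h) => t tE.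
rewrite /= dE tE; apply/seteqP.
split=> [_ [g [k [a [[i Ui pi] [b _ [/dualv_inj ba <-]] ->]]]]|_ [i Ui <-]].
  by exists i; rewrite ?pi // ba.
exists (p i).2, (F (p i).1, tt), (p i).1; split=> //; last by exists (p i).1.
by exists i => //; case: (p i).
Qed.

(** [F_ctx] without the closing name, so that any rest of a context can follow it in the induction
    on cuts. *)
Fixpoint F_vals (y : name -> name) (D : ctx) : den_ctx D -> den_ctx (lneg_ctx y D) :=
  match D return den_ctx D -> den_ctx (lneg_ctx y D) with
  | [::] => id
  | (x, A) :: D => fun v => (F v.1, F_vals y v.2)
  end.

Lemma F_ctxE (y : name -> name) (z : name) (D : ctx) (v : den_ctx D) :
  F_ctx y z v = cat_val (D := [:: (z, One)]) (F_vals y v) (tt, tt).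
Proof. by elim: D v => [|[x A] D IHD] //= v; rewrite IHD. Qed.

(** The rest [G] is arbitrary because each cut moves a translated name into it; the common index
    keeps the values of the two parts correlated. *)
Lemma kdenote_transformer_cuts (y : name -> name) (T D : ctx) (K : pctx) (G : ctx)
    (h : uniq (dom (D ++ lneg_ctx y D ++ G))) (d : ktyped K T (D ++ G))
    (X : set (den_ctx T)) (I : Type) (U : set I)
    (p : I -> den_ctx D) (q : I -> den_ctx G) :
  kdenote d X = [set cat_val (p i) (q i) | i in U] ->
  kdenote (transformer_cuts_typed h d) X = [set cat_val (F_vals y (p i)) (q i) | i in U].
Proof.
elim: D K G h d p q => [|[x A] D IHD] K G h d p q dE //.
lazy beta delta [transformer_cuts_typed list_rect] iota.
(* The image of the name just cut waits at the head of the rest; the outer exchange brings it back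
   in front of the other translated names. *)
pose q' i : den_ctx ((y x, lneg A) :: G) := (F (p i).1, q i).
apply: (@kdenote_exchange _ _ _ _ _ _ _ _ _
  (fun i => cat_val (F_vals y (p i).2) (q' i)) (fun i => cat_val (F_vals y (p i)) (q i))) => [|i]; last first.
  by rewrite /reordering entries_cat /= entries_cat -cat1s perm_catCA.
apply: (IHD _ _ _ _ (fun i => (p i).2) q').
apply: (kdenote_exchange _ (kdenote_cut_transformer _ _ dE)) => i.
by rewrite /reordering !entries_cat /= -catA perm_cat2l cats1 perm_rcons.
Qed.

Theorem theorem32 (D : ctx) (y : name -> name) (z : name)
    (yz_fresh : fresh_for y z D) (X : set (den_ctx D)) :
  kdenote (transformer_ctx_typed yz_fresh) X = [set F_ctx y z v | v in X].
Proof.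
lazy beta delta [transformer_ctx_typed] iota.
(* The cuts start from an empty rest, and appending [[::]] does not compute away; [w] is the value
   in that shape, before the last exchange. *)
pose w v : den_ctx ((lneg_ctx y D ++ [::]) ++ [:: (z, One)]) :=
  cat_val (D := [:: (z, One)]) (cat_val (D := [::]) (F_vals y v) tt) (tt, tt).
apply: (@kdenote_exchange _ _ _ _ _ _ _ _ _ w) => [|v]; last first.
  by rewrite /reordering F_ctxE !entries_cat /= cats0.
(* The same adjustment at the hole, whose context also gets an empty rest. *)
have dE (e : perm_eq D (D ++ [::])) (h : uniq (dom D)) :
    kdenote (k_exchange e (k_hole h)) X = [set cat_val (D := [::]) v tt | v in X].
  apply: (@kdenote_exchange _ _ _ _ _ _ _ _ _ id); first by rewrite image_id.
  by move=> v; rewrite /reordering entries_cat cats0.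
rewrite [LHS]/= (@kdenote_transformer_cuts y _ _ _ [::] _ _ _ _ _ id (fun=> tt) (dE _ _)).
apply/seteqP; split=> [_ [_ [_ [[v Xv <-] -> ->]]]|_ [v Xv <-]]; first by exists v.
exists (cat_val (D := [::]) (F_vals y v) tt), (tt, tt); split=> //.
by exists v.
Qed.
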